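(* For every integer $n$ there exists an undirected simple graph $G$ such that $\chi_{(0,2)}(G)-\chi_{(1,0)}(G)=n$.
   Context: For integers $m,n\ge0$, an $(m,n)$-colored mixed graph has arcs colored with $m$ colors and edges colored with $n$ colors, with simple underlying undirected graph. A homomorphism $f:G\to H$ maps vertices to vertices so that every arc (resp. edge) $uv$ of color $c$ is sent to an arc (resp. edge) $f(u)f(v)$ of color $c$ (arcs keep direction). For an $(m,n)$-colored mixed graph $G$, $\chi_{(m,n)}(G)$ is the minimum order of an $(m,n)$-colored mixed graph $H$ with a homomorphism $G\to H$. For an undirected simple graph $G$, $\chi_{(m,n)}(G)$ is the maximum of $\chi_{(m,n)}$ over all $(m,n)$-colored mixed graphs with underlying graph $G$. Thus $\chi_{(1,0)}(G)$ is the oriented chromatic number (maximum over orientations of $G$) and $\chi_{(0,2)}(G)$ is the maximum over all 2-edge-colorings of $G$. *)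

(* Defs.v *)
From HB Require Import structures.
From mathcomp Require Import all_boot all_order all_algebra.
From mathcomp Require Import boolp.

Set Implicit Arguments.
Unset Strict Implicit.
Unset Printing Implicit Defensive.

Record simple_graph (V : finType) := SimpleGraph {
  adj :> rel V;
  adj_sym : symmetric adj;
  adj_irr : irreflexive adj
}.

(* The number of arcs and edges, of any color and direction, joining [u] and
   [v].  When [u = v] each directed loop is counted twice, which is harmless
   since this number is only tested for being positive or being at most 1. *)
Definition multiplicity (m n : nat) (V : finType)
    (arc : 'I_m -> rel V) (edge : 'I_n -> rel V) (u v : V) : nat :=
  #|[set c | arc c u v]| + #|[set c | arc c v u]| + #|[set c | edge c u v]|.

(* [mixed_simple] says that the underlying undirected graph is simple: there
   are no loops, and two distinct vertices are joined by at most one arc or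
   edge, so there are neither parallel edges of different colors nor pairs of
   opposite arcs. *)
Record mixed_graph (m n : nat) (V : finType) := MixedGraph {
  arc : 'I_m -> rel V;
  edge : 'I_n -> rel V;
  edge_sym : forall c, symmetric (edge c);
  mixed_simple : forall u v, multiplicity arc edge u v <= (u != v)
}.

Definition underlying (m n : nat) (V : finType) (M : mixed_graph m n V) :
  rel V := fun u v => 0 < multiplicity (arc M) (edge M) u v.

Definition hom (m n : nat) (V W : finType)
    (M : mixed_graph m n V) (H : mixed_graph m n W) (f : V -> W) : Prop :=
  (forall c u v, arc M c u v -> arc H c (f u) (f v)) /\
  (forall c u v, edge M c u v -> edge H c (f u) (f v)).

Definition has_target (m n : nat) (V : finType) (M : mixed_graph m n V)
    (k : nat) : Prop :=
  exists (W : finType) (H : mixed_graph m n W),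
    #|W| = k /\ exists f : V -> W, hom M H f.

Lemma has_target_order (m n : nat) (V : finType) (M : mixed_graph m n V) :
  has_target M #|V|.
Proof. by exists V, M; split=> //; exists id. Qed.

Lemma ex_target (m n : nat) (V : finType) (M : mixed_graph m n V) :
  exists k, `[< has_target M k >].
Proof. by exists #|V|; apply/asboolP/has_target_order. Qed.

Definition mixed_chi (m n : nat) (V : finType) (M : mixed_graph m n V) : nat :=
  ex_minn (ex_target M).

Lemma mixed_chi_leq (m n : nat) (V : finType) (M : mixed_graph m n V) :
  mixed_chi M <= #|V|.
Proof.
rewrite /mixed_chi; case: ex_minnP => k _; apply.
exact/asboolP/has_target_order.
Qed.

Definition mixed_chi_value (m n : nat) (V : finType) (G : simple_graph V)
    (k : nat) : Prop :=
  exists2 M : mixed_graph m n V, underlying M =2 G & mixed_chi M = k.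

(* By [mixed_chi_leq], bounding the range by [#|V|] loses no value.  The
   maximum is over an empty set, hence 0, only when [m = n = 0] and [G] has an
   edge. *)
Definition chi (m n : nat) (V : finType) (G : simple_graph V) : nat :=
  \max_(k < #|V|.+1 | `[< mixed_chi_value m n G k >]) k.

Lemma mixed_chi_leq_chi (m n : nat) (V : finType) (G : simple_graph V)
    (M : mixed_graph m n V) :
  underlying M =2 G -> mixed_chi M <= chi m n G.
Proof.
move=> MG; have lt_chi : mixed_chi M < #|V|.+1 by rewrite ltnS mixed_chi_leq.
apply: (@leq_bigmax_cond _ _ _ (Ordinal lt_chi)).
by apply/asboolP; exists M.
Qed.

Lemma chi_attained (m n : nat) (V : finType) (G : simple_graph V)
    (M : mixed_graph m n V) :
  underlying M =2 G -> mixed_chi_value m n G (chi m n G).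
Proof.
move=> MG; have lt_chi : mixed_chi M < #|V|.+1 by rewrite ltnS mixed_chi_leq.
have PM : `[< mixed_chi_value m n G (Ordinal lt_chi) >].
  by apply/asboolP; exists M.
rewrite /chi (bigmax_eq_arg (Ordinal lt_chi)) //.
by case: arg_maxnP => // k /asboolP.
Qed.

(* Main.v *)
(* Joining a new vertex to a clique raises both chromatic numbers by 0 or 1, so
   growing two disjoint cliques next to a fixed graph, vertex by vertex, changes
   the difference by at most 1 at each step, and every value between the two
   ends is attained.

   At the end, the difference is large: a red and a blue clique share at most
   one color, whereas two large tournaments contain isomorphic large transitive
   subtournaments, which can be identified.

   At the start, the difference is very negative: take [k] disjoint 5-cycles
   together with vertices that connect, by oriented 2-paths, any two vertices of
   distinct cycles, without being adjacent to two vertices of the same cycle.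
   Directing the cycles makes all vertices have distinct colors.  But an odd
   cycle has no alternating 2-edge-coloring, so each cycle has a monochromatic
   2-path, whose ends can be identified. *)
Require Import Defs.
From mathcomp Require Import all_boot all_order all_algebra.
From mathcomp Require Import boolp zify.

Set Implicit Arguments.
Unset Strict Implicit.
Unset Printing Implicit Defensive.

Import GRing.Theory.

(* [path.arc] and [vector.hom] shadow those of [Defs]. *)
Import Defs.

(** * Homomorphisms expressed on the source graph *)

(* [M] has a homomorphism to a target with vertex set [W] acting as [f] on
   vertices; see [hom_compat] and [compat_target]. *)
Definition compat (m n : nat) (V W : finType) (M : mixed_graph m n V)
    (f : V -> W) : Prop :=
  (forall u v, underlying M u v -> f u <> f v) /\
  (forall u v u' v', f u = f u' -> f v = f v' ->
    underlying M u v -> underlying M u' v' ->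
    (forall c, arc M c u v = arc M c u' v') /\
    (forall c, edge M c u v = edge M c u' v')).

Lemma underlyingP (m n : nat) (V : finType) (M : mixed_graph m n V) u v :
  reflect ((exists c, arc M c u v || arc M c v u) \/ exists c, edge M c u v)
          (underlying M u v).
Proof.
rewrite /underlying /multiplicity !addn_gt0 !card_gt0; apply: (iffP idP).
  case/orP=> [/orP[]|] /set0Pn[c]; rewrite inE => h.
  - by left; exists c; rewrite h.
  - by left; exists c; rewrite h orbT.
  - by right; exists c.
case=> [[c /orP[h|h]]|[c h]].
- by apply/orP; left; apply/orP; left; apply/set0Pn; exists c; rewrite inE.
- by apply/orP; left; apply/orP; right; apply/set0Pn; exists c; rewrite inE.
- by apply/orP; right; apply/set0Pn; exists c; rewrite inE.
Qed.

(** The larger sizes sum to at most 1 and the smaller ones to at least 1, so every inclusion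
    preserves size. It is meant for the color sets of a pair of vertices and of its image. *)
Lemma sub_eq_of_card (T U : finType) (A A' B B' : {set T}) (C C' : {set U}) :
  A \subset A' -> B \subset B' -> C \subset C' ->
  #|A'| + #|B'| + #|C'| <= 1 -> 0 < #|A| + #|B| + #|C| ->
  A = A' /\ C = C'.
Proof.
move=> sA sB sC le1 gt0.
have := (subset_leq_card sA, subset_leq_card sB, subset_leq_card sC).
move=> [[lA lB] lC].
by split; apply/eqP; rewrite eqEcard ?sA ?sC /=; lia.
Qed.

(** The image of an adjacent pair carries at most one arc or edge, hence exactly that of the pair;
    so the colors depend only on [f u] and [f v]. *)
Lemma hom_compat (m n : nat) (V W : finType) (M : mixed_graph m n V)
    (H : mixed_graph m n W) (f : V -> W) : hom M H f -> compat M f.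
Proof.
case=> fa fe.
have HP u v : underlying M u v ->
    [/\ f u != f v, [set c | arc M c u v] = [set c | arc H c (f u) (f v)]
      & [set c | edge M c u v] = [set c | edge H c (f u) (f v)]].
  move=> Muv; have sH := mixed_simple H (f u) (f v).
  have [] := @sub_eq_of_card _ _ [set c | arc M c u v]
    [set c | arc H c (f u) (f v)] [set c | arc M c v u]
    [set c | arc H c (f v) (f u)] [set c | edge M c u v]
    [set c | edge H c (f u) (f v)].
  - by apply/subsetP=> c; rewrite !inE; apply: fa.
  - by apply/subsetP=> c; rewrite !inE; apply: fa.
  - by apply/subsetP=> c; rewrite !inE; apply: fe.
  - exact: leq_trans sH (leq_b1 _).
  - exact: Muv.
  move=> eA eC; split=> //; apply/eqP=> fuv.
  have /underlyingP := Muv.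
  move: sH; rewrite fuv eqxx leqn0 /multiplicity !addn_eq0 !cards_eq0.
  move=> /andP[/andP[/eqP/setP A0 _] /eqP/setP C0].
  case=> [[c /orP[]/fa]|[c /fe]]; rewrite fuv => h.
  - by have := A0 c; rewrite !inE h.
  - by have := A0 c; rewrite !inE h.
  - by have := C0 c; rewrite !inE h.
split=> [u v /HP[/eqP]//|u v u' v' fu fv /HP[_ eA eC] /HP[_ eA' eC']].
split=> c.
- have /setP/(_ c) : [set c | arc M c u v] = [set c | arc M c u' v'].
    by rewrite eA eA' fu fv.
  by rewrite !inE.
- have /setP/(_ c) : [set c | edge M c u v] = [set c | edge M c u' v'].
    by rewrite eC eC' fu fv.
  by rewrite !inE.
Qed.

Lemma underlying_sym (m n : nat) (V : finType) (M : mixed_graph m n V) :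
  symmetric (underlying M).
Proof.
move=> u v; apply/underlyingP/underlyingP.
- case=> [[c h]|[c h]]; first by left; exists c; rewrite orbC.
  by right; exists c; rewrite edge_sym.
- case=> [[c h]|[c h]]; first by left; exists c; rewrite orbC.
  by right; exists c; rewrite edge_sym.
Qed.

(** The target is the image of [M] on [W]: an arc or edge is present when some pair above it has
    it. *)
Lemma compat_target (m n : nat) (V W : finType) (M : mixed_graph m n V)
    (f : V -> W) : compat M f -> has_target M #|W|.
Proof.
case=> f1 f2.
pose a c x y := [exists u, exists v, [&& f u == x, f v == y & arc M c u v]].
pose e c x y := [exists u, exists v, [&& f u == x, f v == y & edge M c u v]].
have aP c x y : reflect (exists u v, [/\ f u = x, f v = y & arc M c u v]) (a c x y).
  apply: (iffP existsP) => [[u /existsP[v /and3P[/eqP ? /eqP ? ?]]]|].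
    by exists u, v.
  by case=> u [v [<- <- h]]; exists u; apply/existsP; exists v; rewrite !eqxx.
have eP c x y : reflect (exists u v, [/\ f u = x, f v = y & edge M c u v]) (e c x y).
  apply: (iffP existsP) => [[u /existsP[v /and3P[/eqP ? /eqP ? ?]]]|].
    by exists u, v.
  by case=> u [v [<- <- h]]; exists u; apply/existsP; exists v; rewrite !eqxx.
have e_sym c : symmetric (e c).
  move=> x y; apply/eP/eP => -[u [v [? ? h]]]; exists v, u;
  by rewrite edge_sym.
have e_simp x y : multiplicity a e x y <= (x != y).
  (* A single adjacent pair [u0], [v0] above [x], [y] bounds the multiplicity: by compatibility its
     color sets contain those of the image. *)
  have [/existsP[u0 /existsP[v0 /and3P[/eqP eu /eqP ev Muv]]]|no] :=
    boolP [exists u, exists v, [&& f u == x, f v == y & underlying M u v]].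
    have -> : x != y by apply/eqP; rewrite -eu -ev; apply: f1.
    apply: leq_trans (leq_trans (mixed_simple M u0 v0) (leq_b1 _)).
    rewrite /multiplicity !leq_add //; apply: subset_leq_card;
      apply/subsetP => c; rewrite !inE.
    - case/aP=> u [v [fu fv h]].
      have Mh : underlying M u v by apply/underlyingP; left; exists c; rewrite h.
      by have [<-] := f2 u v u0 v0 (etrans fu (esym eu)) (etrans fv (esym ev)) Mh Muv.
    - case/aP=> u [v [fu fv h]].
      have Mh : underlying M u v by apply/underlyingP; left; exists c; rewrite h.
      rewrite underlying_sym in Muv.
      by have [<-] := f2 u v v0 u0 (etrans fu (esym ev)) (etrans fv (esym eu)) Mh Muv.
    - case/eP=> u [v [fu fv h]].
      have Mh : underlying M u v by apply/underlyingP; right; exists c.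
      by have [_ <-] := f2 u v u0 v0 (etrans fu (esym eu)) (etrans fv (esym ev)) Mh Muv.
  suff -> : multiplicity a e x y = 0 by [].
  apply/eqP; rewrite /multiplicity !addn_eq0 !cards_eq0.
  have noM u v : f u = x -> f v = y -> underlying M u v -> False.
    move=> fu fv h; case/negP: no; apply/existsP; exists u.
    by apply/existsP; exists v; rewrite fu fv !eqxx.
  apply/andP; split; first (apply/andP; split); apply/eqP/setP=> c; rewrite !inE.
  - apply/aP=> -[u [v [fu fv h]]]; apply: (noM u v fu fv).
    by apply/underlyingP; left; exists c; rewrite h.
  - apply/aP=> -[u [v [fu fv h]]]; apply: (noM v u fv fu).
    by apply/underlyingP; left; exists c; rewrite h orbT.
  - apply/eP=> -[u [v [fu fv h]]]; apply: (noM u v fu fv).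
    by apply/underlyingP; right; exists c.
exists W, (MixedGraph e_sym e_simp); split=> //; exists f; split=> c u v h /=.
- by apply/aP; exists u, v.
- by apply/eP; exists u, v.
Qed.

(** Corestricting [f] to its image discards the elements of [W] that are not attained. *)
Lemma mixed_chi_le_card (m n : nat) (V W : finType) (M : mixed_graph m n V)
    (f : V -> W) : compat M f -> mixed_chi M <= #|f @: V|.
Proof.
case=> f1 f2; have fI u : f u \in f @: V by apply: imset_f.
pose g u : {x | x \in f @: V} := exist _ (f u) (fI u).
have fg u v : g u = g v -> f u = f v by move/(congr1 val).
have cg : compat M g.
  by split=> [u v /f1 + /fg //|u v u' v' /fg + /fg]; exact: f2.
rewrite /mixed_chi; case: ex_minnP => k _; rewrite -card_sig; apply.
exact/asboolP/(compat_target cg).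
Qed.

Lemma mixed_chi_compat (m n : nat) (V : finType) (M : mixed_graph m n V) :
  exists (W : finType) (f : V -> W), #|W| = mixed_chi M /\ compat M f.
Proof.
rewrite /mixed_chi; case: ex_minnP => k /asboolP[W [H [<- [f fH]]]] _.
by exists W, f; split=> //; apply: hom_compat fH.
Qed.

Lemma chi_leq (m n : nat) (V : finType) (G : simple_graph V) (k : nat) :
  (forall M : mixed_graph m n V, underlying M =2 G -> mixed_chi M <= k) ->
  chi m n G <= k.
Proof.
by move=> le_k; apply/bigmax_leqP => i /asboolP[M MG <-]; apply: le_k.
Qed.

Lemma leq_chi (m n : nat) (V : finType) (G : simple_graph V)
    (M : mixed_graph m n V) (k : nat) :
  underlying M =2 G ->
  (forall (W : finType) (f : V -> W), compat M f -> k <= #|W|) ->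
  k <= chi m n G.
Proof.
move=> MG kP; apply: leq_trans (mixed_chi_leq_chi MG).
by have [W [f [<-]]] := mixed_chi_compat M; apply: kP.
Qed.

(** * Oriented graphs, 2-edge-colored graphs and restrictions *)

Section Orient.
Variables (V : finType) (r : rel V).
Hypothesis r_asym : forall u v, r u v -> ~~ r v u.

Lemma orient_simple u v :
  multiplicity (fun _ : 'I_1 => r) (fun _ : 'I_0 => r) u v <= (u != v).
Proof.
rewrite /multiplicity [X in _ + X]eq_card0 => [|[]//]; rewrite addn0.
have cst b : #|[set c : 'I_1 | b]| = b.
  by case: b; rewrite ?cardsE ?card_ord ?eq_card0 // => c; rewrite !inE.
rewrite !cst; case: eqVneq => [<-|_].
  by case h: (r u u) => //; have := r_asym h; rewrite h.
by case h: (r u v); rewrite ?(negbTE (r_asym h)) ?leq_b1.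
Qed.

Lemma edge0_sym (c : 'I_0) : symmetric r.
Proof. by case: c. Qed.

Definition orient : mixed_graph 1 0 V := MixedGraph edge0_sym orient_simple.

Lemma underlying_orient u v : underlying orient u v = r u v || r v u.
Proof.
apply/underlyingP/idP => [[[c]//|[[]//]]|h].
by left; exists ord0.
Qed.
End Orient.

Section Bicolor.
Variables (V : finType) (r s : rel V).
Hypotheses (r_sym : symmetric r) (r_irr : irreflexive r) (s_sym : symmetric s).

(** [s] selects the edges of color [ord0]; comparing booleans gives every edge of [r] exactly one of
    the two colors. *)
Let bicolor_edge (c : 'I_2) : rel V :=
  fun u v => r u v && (s u v == (c == ord0)).

Lemma bicolor_edge_sym c : symmetric (bicolor_edge c).
Proof. by move=> u v; rewrite /bicolor_edge r_sym s_sym. Qed.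

Lemma bicolor_simple u v :
  multiplicity (fun (_ : 'I_0) => r) bicolor_edge u v <= (u != v).
Proof.
have z (A : {set 'I_0}) : #|A| = 0 by apply: eq_card0 => -[].
rewrite /multiplicity /bicolor_edge !z !add0n; case: eqVneq => [<-|_] /=.
  by rewrite leqn0 cards_eq0; apply/eqP/setP=> c; rewrite !inE r_irr.
apply/card_le1_eqP => -[[|[|//]] ?] [[|[|//]] ?]; rewrite !inE /eq_op /=;
  by case: (s u v); rewrite ?andbF // => _ _; apply: val_inj.
Qed.

Definition bicolor : mixed_graph 0 2 V :=
  MixedGraph bicolor_edge_sym bicolor_simple.

Lemma underlying_bicolor : underlying bicolor =2 r.
Proof.
move=> u v; apply/underlyingP/idP => [[[[]//]|[c /andP[]//]]|h].
right; exists (if s u v then ord0 else ord_max); rewrite /= /bicolor_edge h.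
by case: (s u v).
Qed.

Lemma bicolor_compat (W : finType) (f : V -> W) u v u' v' :
  compat bicolor f -> f u = f u' -> f v = f v' -> r u v -> r u' v' ->
  s u v = s u' v'.
Proof.
case=> _ cf fu fv ruv ruv'.
have [//||_ /(_ ord0)] := cf u v u' v' fu fv.
- by rewrite underlying_bicolor.
- by rewrite underlying_bicolor.
by rewrite /= /bicolor_edge ruv ruv' !eqxx !eqb_id.
Qed.
End Bicolor.

Section Restrict.
Variables (m n : nat) (V : finType) (M : mixed_graph m n V) (P : rel V).
Hypothesis P_sym : symmetric P.

Let sub_arc c : rel V := fun u v => arc M c u v && P u v.
Let sub_edge c : rel V := fun u v => edge M c u v && P u v.

Lemma sub_edge_sym c : symmetric (sub_edge c).
Proof. by move=> u v; rewrite /sub_edge edge_sym P_sym. Qed.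

Lemma sub_simple u v : multiplicity sub_arc sub_edge u v <= (u != v).
Proof.
apply: leq_trans (mixed_simple M u v); rewrite /multiplicity !leq_add //;
  by apply: subset_leq_card; apply/subsetP=> c; rewrite !inE => /andP[].
Qed.

Definition restrict : mixed_graph m n V := MixedGraph sub_edge_sym sub_simple.

Lemma underlying_restrict u v :
  underlying restrict u v = underlying M u v && P u v.
Proof.
apply/underlyingP/andP => [[[c]|[c]]|[/underlyingP[[c h]|[c h]] Puv]].
- rewrite /= /sub_arc (P_sym v) -andb_orl => /andP[h ->]; split=> //.
  by apply/underlyingP; left; exists c.
- by move=> /= /andP[h ->]; split=> //; apply/underlyingP; right; exists c.
- by left; exists c; rewrite /= /sub_arc (P_sym v) -andb_orl h.
- by right; exists c; rewrite /= /sub_edge h.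
Qed.
End Restrict.

(** * Chromatic numbers of a growing graph *)

(* Give [v0] a fresh color: as its neighbors form a clique of [G], they have
   pairwise distinct colors. *)
Lemma chi_clique_extension (m n : nat) (V : finType) (G G' : simple_graph V)
    (v0 : V) :
  subrel G G' -> (forall u v, u != v0 -> v != v0 -> G' u v = G u v) ->
  (forall u v, G' v0 u -> G' v0 v -> u != v -> G u v) ->
  chi m n G' <= (chi m n G).+1.
Proof.
move=> sGG' eGG' clique; apply: chi_leq => M' M'G'.
pose M := restrict M' (adj_sym G).
have MG : underlying M =2 G.
  move=> u v; rewrite underlying_restrict M'G'.
  by case h: (G u v); rewrite ?andbF // (sGG' _ _ h).
apply: leq_trans (_ : (mixed_chi M).+1 <= _); last first.
  by rewrite ltnS mixed_chi_leq_chi.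
have [W [f [<- [f1 f2]]]] := mixed_chi_compat M.
rewrite -card_option; pose g u := if u == v0 then None else Some (f u).
have G'irr u v : G' u v -> u != v by apply: contraTneq => ->; rewrite adj_irr.
have gE u v : g u = g v -> (u == v0) = (v == v0) /\ (u != v0 -> f u = f v).
  by rewrite /g; do 2!case: eqP => // _; move=> [].
have inj_nbr u v : G' v0 u -> G' v0 v -> f u = f v -> u = v.
  move=> h h' e; apply/eqP; apply/negPn/negP=> ne.
  by case: (f1 u v) => //; rewrite MG; apply: clique.
have cg : compat M' g.
  split=> [u v|u v u' v' /gE[eu fu] /gE[ev fv]]; rewrite !M'G' => h.
    move/gE=> [e fe]; have [u0|u0] := eqVneq u v0.
      by have := G'irr _ _ h; move: e; rewrite u0 eqxx eq_sym => <-.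
    by case: (f1 u v); [rewrite MG -eGG' -?e|exact: fe].
  (* An edge at [v0] can only coincide with another edge at [v0], and then [inj_nbr] makes the other
     ends equal. Away from [v0], both edges lie in [G]. *)
  move=> h'; have [u0|u0] := eqVneq u v0.
    have u0' : u' = v0 by apply/eqP; rewrite -eu u0.
    subst u u'; have v0N : v != v0 by rewrite eq_sym (G'irr _ _ h).
    by rewrite (inj_nbr v v') ?fv.
  have [v0E|v0N] := eqVneq v v0.
    have v0' : v' = v0 by apply/eqP; rewrite -ev v0E.
    subst v v'; rewrite (inj_nbr u u') ?fu //; by rewrite adj_sym.
  have Muv : underlying M u v by rewrite MG -eGG'.
  have Muv' : underlying M u' v' by rewrite MG -eGG' -?eu -?ev.
  have [ea ee] := f2 u v u' v' (fu u0) (fv v0N) Muv Muv'.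
  move: Muv Muv'; rewrite !underlying_restrict => /andP[_ Guv] /andP[_ Guv'].
  split=> c; first by have := ea c; rewrite /= Guv Guv' !andbT.
  by have := ee c; rewrite /= Guv Guv' !andbT.
exact: leq_trans (mixed_chi_le_card cg) (max_card _).
Qed.

Lemma arc_asym (m n : nat) (V : finType) (M : mixed_graph m n V) c u v :
  arc M c u v -> ~~ arc M c v u.
Proof.
move=> h; apply/negP=> h'; have := mixed_simple M u v.
move/leq_trans/(_ (leq_b1 _)); rewrite /multiplicity.
rewrite (cardD1 c) inE h (cardD1 c [set c0 | arc M c0 v u]) inE h'; lia.
Qed.

(** An orientation of [G] extends to [G'] by directing the new edges along the enumeration of [V],
    and a map compatible with the extension is compatible with the original. *)
Lemma leq_chi_oriented (V : finType) (G G' : simple_graph V) :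
  subrel G G' -> chi 1 0 G <= chi 1 0 G'.
Proof.
move=> sGG'; apply: chi_leq => M MG.
pose r u v := arc M ord0 u v ||
  [&& G' u v, ~~ G u v & enum_rank u < enum_rank v].
have arcG u v : arc M ord0 u v -> G u v.
  by move=> h; rewrite -MG; apply/underlyingP; left; exists ord0; rewrite h.
have r_asym u v : r u v -> ~~ r v u.
  case/orP=> [h|/and3P[_ nG lt]]; rewrite negb_or.
    by rewrite arc_asym // (adj_sym G) arcG // andbF.
  rewrite !negb_and -leqNgt (ltnW lt) !orbT andbT; apply: contra nG.
  by move/arcG; rewrite adj_sym.
have rG' : underlying (orient r_asym) =2 G'.
  move=> u v; rewrite underlying_orient /r (adj_sym G' v) (adj_sym G v).
  apply/idP/idP => [/orP[/orP[/arcG/sGG'//|/andP[]//]|]|h].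
    by case/orP=> [/arcG|/andP[]//]; rewrite adj_sym; apply: sGG'.
  have [Guv|nG] := boolP (G u v).
    move: Guv; rewrite -MG => /underlyingP[[c]|[[]//]]; rewrite (ord1 c).
    by case/orP=> ->; rewrite ?orbT.
  rewrite h /=; case: ltngtP; rewrite ?orbT // => /ord_inj/enum_rank_inj e.
  by move: h; rewrite e adj_irr.
apply: (leq_chi rG') => W f [f1 f2].
have arcr u v : arc M ord0 u v -> r u v by rewrite /r => ->.
have uM u v : underlying M u v -> underlying (orient r_asym) u v.
  by rewrite MG rG'; apply: sGG'.
have cf : compat M f.
  split=> [u v /uM/f1//|u v u' v' fu fv Muv Muv']; split=> -[] // [] // i.
  rewrite (_ : Ordinal i = ord0); last exact: val_inj.
  have [/(_ ord0) /= + _] := f2 _ _ _ _ fu fv (uM _ _ Muv) (uM _ _ Muv').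
  by move: Muv Muv'; rewrite !MG /r => -> ->; rewrite !andbF !orbF.
exact: leq_trans (mixed_chi_le_card cf) (max_card _).
Qed.

(** * Transitive subtournaments *)

(** Among the at least [2 ^ s.+1 - 1] elements other than [v], at least [2 ^ s] are out-neighbors or
    at least [2 ^ s] are in-neighbors; [v] is put before or after the sequence found there. *)
Lemma transitive_subtournament (T : finType) (r : rel T) (s : nat)
    (A : {set T}) :
  {in A &, forall u v, u != v -> r u v || r v u} -> 2 ^ s <= #|A| ->
  exists t : seq T, [/\ size t = s, uniq t, {subset t <= A} & pairwise r t].
Proof.
elim: s A => [|s IHs] A r_tot leA; first by exists [::].
have /card_gt0P[v Av] : 0 < #|A| by apply: leq_trans leA; rewrite expn_gt0.
pose Out := [set u in A :\ v | r v u]; pose In := [set u in A :\ v | r u v].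
have sOut : {subset Out <= A :\ v} by move=> u; rewrite inE => /andP[].
have sIn : {subset In <= A :\ v} by move=> u; rewrite inE => /andP[].
have sA (B : {set T}) : {subset B <= A :\ v} -> {subset B <= A}.
  by move=> sB u /sB /setD1P[].
have: 2 ^ s <= #|Out| \/ 2 ^ s <= #|In|.
  have : #|A :\ v| <= #|Out| + #|In|.
    rewrite -cardsUI (leq_trans _ (leq_addr _ _)) // subset_leq_card //.
    apply/subsetP=> u Au; rewrite !inE -andb_orr -in_setD1 Au /=.
    by case/setD1P: Au => ne Au; apply: r_tot; rewrite // eq_sym.
  by move: leA; rewrite (cardsD1 v A) Av expnS; lia.
have sub_tot (B : {set T}) : {subset B <= A :\ v} ->
    {in B &, forall x y, x != y -> r x y || r y x}.
  by move=> /sA sB x y /sB Ax /sB Ay; apply: r_tot.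
case=> [/(IHs _ (sub_tot _ sOut))|/(IHs _ (sub_tot _ sIn))] [t [st ut tS pt]].
- exists (v :: t); split=> /=; first by rewrite st.
  + rewrite ut andbT; apply/negP=> /tS/sOut; by rewrite !inE eqxx.
  + by move=> u; rewrite inE => /predU1P[->//|/tS/(sA _ sOut)].
  + by rewrite pt andbT; apply/allP=> u /tS; rewrite inE => /andP[].
- exists (rcons t v); split; first by rewrite size_rcons st.
  + rewrite rcons_uniq ut andbT; apply/negP=> /tS/sIn; by rewrite !inE eqxx.
  + by move=> u; rewrite mem_rcons inE => /predU1P[->//|/tS/(sA _ sIn)].
  + by rewrite pairwise_rcons pt andbT; apply/allP=> u /tS; rewrite inE => /andP[].
Qed.

(** Asymmetry excludes backward arcs. Hence matching positions is an isomorphism between two such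
    sequences of equal length. *)
Lemma pairwise_index (T : eqType) (r : rel T) (t : seq T) u v :
  (forall x y, r x y -> ~~ r y x) -> pairwise r t ->
  u \in t -> v \in t -> r u v = (index u t < index v t).
Proof.
move=> r_asym pt tu tv.
have lt x y : x \in t -> y \in t -> index x t < index y t -> r x y.
  move=> tx ty lt_xy; move/(pairwiseP x): pt.
  move/(_ (index x t) (index y t)); rewrite !nth_index //.
  by apply; rewrite ?inE ?index_mem.
case: ltngtP => [|/lt h|]; first exact: lt.
  by apply/negbTE/r_asym/h.
move/(congr1 (nth u t)); rewrite !nth_index // => ->.
by apply/negP=> h; have := r_asym _ _ h; rewrite h.
Qed.

(** * Adding two disjoint cliques *)

Section PlusCliques.
Variables (V : finType) (G : simple_graph V) (K L : nat).

(* [plus_cliques j] is the disjoint union of [G], two cliques on the vertices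
   [x < minn j K] and [K <= x < j], and isolated vertices. *)
Let plus_cliques_rel (j : nat) : rel (V + 'I_(K + L)) := fun u v =>
  match u, v with
  | inl u, inl v => G u v
  | inr x, inr y => [&& x != y, x < j, y < j & (x < K) == (y < K)]
  | _, _ => false
  end.

Lemma plus_cliques_sym j : symmetric (plus_cliques_rel j).
Proof.
case=> [u|x] [v|y] //=; first exact: adj_sym.
by rewrite [y == x]eq_sym [(y < K) == _]eq_sym; case: (x != y); lia.
Qed.

Lemma plus_cliques_irr j : irreflexive (plus_cliques_rel j).
Proof. by case=> [u|x] /=; rewrite ?adj_irr ?eqxx. Qed.

Definition plus_cliques j : simple_graph (V + 'I_(K + L))%type :=
  SimpleGraph (plus_cliques_sym j) (plus_cliques_irr j).

Lemma plus_cliques_sub j : subrel (plus_cliques j) (plus_cliques j.+1).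
Proof. by case=> [u|x] [v|y] //= /and4P[-> *]; apply/and3P; split; lia. Qed.

(** The vertex [j], isolated so far, gets joined to the earlier vertices on its side of [K], which
    already form a clique. *)
Lemma chi_plus_cliques_step m n j : j < K + L ->
  chi m n (plus_cliques j.+1) <= (chi m n (plus_cliques j)).+1.
Proof.
move=> ltj; apply: (@chi_clique_extension _ _ _ _ _ (inr (Ordinal ltj))).
- exact: plus_cliques_sub.
- have neq x : inr x != inr (Ordinal ltj) :> V + 'I_(K + L) ->
    (x < j.+1) = (x < j).
    by rewrite -[_ == _]/(x == _) -val_eqE /=; lia.
  by case=> [u|x] [v|y] //= /neq-> /neq->.
- case=> [u|x] [v|y] //= /and4P[+ _ + +] /and4P[+ _ + +] ne.
  rewrite -!val_eqE /= => *; apply/and4P; split; try lia.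
  by move: ne; rewrite -[_ == _]/(x == y).
Qed.

(** The first clique gets color [ord0], the second the other color. A compatible map is injective on
    each clique, and two shared images would be joined in both colors. *)
Lemma chi02_two_cliques : K + L <= (chi 0 2 (plus_cliques (K + L))).+1.
Proof.
set H := plus_cliques _.
pose s (u v : V + 'I_(K + L)) :=
  if (u, v) is (inr x, inr y) then (x < K) && (y < K) else false.
have s_sym : symmetric s by rewrite /s => -[u|x] [v|y] //; rewrite andbC.
suff: (K + L).-1 <= chi 0 2 H by lia.
apply: (leq_chi (underlying_bicolor (adj_sym H) (adj_irr H) s_sym)) => W f cf.
have adjE (x y : 'I_(K + L)) : x != y -> (x < K) = (y < K) -> H (inr x) (inr y).
  by move=> ne e; rewrite /= ne e eqxx !ltn_ord.
have f_inj (x y : 'I_(K + L)) : (x < K) = (y < K) -> f (inr x) = f (inr y) -> x = y.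
  move=> e fxy; apply/eqP; apply/negPn/negP => ne.
  case: cf => /(_ (inr x) (inr y)) + _; rewrite underlying_bicolor.
  by move/(_ (adjE _ _ ne e)).
pose fl (x : 'I_K) := f (inr (lshift L x)).
pose fr (y : 'I_L) := f (inr (rshift K y)).
have ltl (x : 'I_K) : lshift L x < K by exact: (ltn_ord x).
have ltr (y : 'I_L) : (rshift K y < K) = false by rewrite /=; lia.
have fl_inj : injective fl.
  by move=> x y /f_inj; rewrite !ltl => /(_ erefl)/lshift_inj.
have fr_inj : injective fr.
  by move=> x y /f_inj; rewrite !ltr => /(_ erefl)/rshift_inj.
have: #|fl @: 'I_K :&: fr @: 'I_L| <= 1.
  apply/card_le1_eqP=> w w' /setIP[/imsetP[x _ ->] /imsetP[y _ exy]].
  move=> /setIP[/imsetP[x' _ ->] /imsetP[y' _ exy']] {w w'}.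
  have [->//|ne] := eqVneq x x'.
  have ney : y != y'.
    by apply: contra_neq ne => e; apply: fl_inj; rewrite exy exy' e.
  have := bicolor_compat cf exy exy'.
  rewrite /s !ltl !ltr => h; suff: true = false by [].
  apply: h; apply: adjE; rewrite ?ltl ?ltr //.
  by apply: contra_neq ney => /rshift_inj.
have := cardsUI (fl @: 'I_K) (fr @: 'I_L).
rewrite !card_imset // !card_ord.
have := max_card (fl @: 'I_K :|: fr @: 'I_L); lia.
Qed.

(** In any orientation, each clique contains a transitive subtournament on [s] vertices; identifying
    these two by position saves [s] colors. *)
Lemma chi10_two_cliques s : 2 ^ s <= K -> 2 ^ s <= L ->
  chi 1 0 (plus_cliques (K + L)) <= #|V| + (K + L) - s.
Proof.
move=> leK leL; set H := plus_cliques _; apply: chi_leq => M MH.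
pose r := arc M ord0; pose T : finType := (V + 'I_(K + L))%type.
have r_asym u v : r u v -> ~~ r v u by apply: arc_asym.
pose side (u : T) := if u is inr x then Some (x < K) else None.
have side_adj u v : H u v -> side u = side v.
  by case: u v => [u|x] [v|y] //= /and4P[_ _ _ /eqP->].
have block (b : bool) k : k <= #|[set u : T | side u == Some b]| ->
  2 ^ s <= k -> exists t : seq T, [/\ size t = s, uniq t,
    forall u, u \in t -> side u = Some b & pairwise r t].
  move=> lek les; have [||t [st ut tS pt]] := @transitive_subtournament _ r s
      [set u : T | side u == Some b].
  - move=> [u|x] [v|y]; rewrite !inE //= => /eqP[ex] /eqP[ey] ne.
    have: underlying M (inr x) (inr y).
      by rewrite MH /= ex ey eqxx !ltn_ord !andbT; apply: contra_neq ne => ->.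
    by case/underlyingP=> [[c]|[[]//]]; rewrite (ord1 c).
  - exact: leq_trans lek.
  by exists t; split=> // u /tS; rewrite inE => /eqP.
have leA : K <= #|[set u : T | side u == Some true]|.
  have inj : injective (fun x : 'I_K => inr (lshift L x) : T).
    by move=> x y [] /val_inj.
  rewrite -[X in X <= _]card_ord -(card_imset _ inj).
  apply/subset_leq_card/subsetP => _ /imsetP[x _ ->].
  by rewrite inE /= ltn_ord.
have [ta [sa ua sta pa]] := block true K leA leK.
have leB : L <= #|[set u : T | side u == Some false]|.
  have inj : injective (fun x : 'I_L => inr (rshift K x) : T).
    by move=> x y [] /addnI/val_inj.
  rewrite -[X in X <= _]card_ord -(card_imset _ inj).
  apply/subset_leq_card/subsetP => _ /imsetP[x _ ->].
  by rewrite inE /= ltnNge leq_addr.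
have [tb [sb ub stb pb]] := block false L leB leL.
(* Each vertex of [tb] goes to the vertex of [ta] at the same position; both sequences have size
   [s], so the default of [nth] is never returned. *)
pose f u := if u \in tb then nth u ta (index u tb) else u.
pose twin u v := [/\ u \in tb, v \in ta & index u tb = index v ta].
have fE u v : f u = f v -> [\/ u = v, twin u v | twin v u].
  have idx w : w \in tb -> index w tb < size ta by rewrite sa -sb index_mem.
  have twinf w : w \in tb -> twin w (nth w ta (index w tb)).
    by move=> tw; split; rewrite ?mem_nth ?index_uniq ?idx.
  rewrite /f; case: ifP => tu; case: ifP => tv.
  - rewrite (set_nth_default v) ?idx // => /eqP; rewrite nth_uniq ?idx //.
    move/eqP/(congr1 (nth u tb)); rewrite !nth_index // => ->.
    by constructor 1.
  - by move=> <-; constructor 2; apply: twinf.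
  - by move=> ->; constructor 3; apply: twinf.
  - by move=> ->; constructor 1.
have twin_side u v : twin u v -> side u = Some false /\ side v = Some true.
  by case=> /stb-> /sta->.
have twin_neq u v : twin u v -> side u <> side v.
  by case/twin_side=> -> ->.
have twin_arc u v u' v' : twin u u' -> twin v v' -> r u v = r u' v'.
  case=> tu tu' eu [tv tv' ev].
  by rewrite (pairwise_index r_asym pb) // (pairwise_index r_asym pa) // eu ev.
have cf : compat M f.
  split=> [u v|u v u' v' /fE fu /fE fv]; rewrite !MH => h.
    move=> /fE[e|/twin_side[]|/twin_side[]]; try by rewrite (side_adj _ _ h) => ->.
    by move: h; rewrite e adj_irr.
  move/side_adj=> h'; move/side_adj in h.
  split=> -[] // [] // i; rewrite (_ : Ordinal i = ord0); last exact: val_inj.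
  (* Adjacent vertices lie on the same side and twins on opposite sides, so either both ends are
     fixed or both pass to their twins in the same direction. *)
  case: fu fv => [eu|tu|tu] [ev|tv|tv].
  - by rewrite eu ev.
  - by case: (twin_neq _ _ tv); rewrite -h -h' eu.
  - by case: (twin_neq _ _ tv); rewrite -h -h' eu.
  - by case: (twin_neq _ _ tu); rewrite h h' ev.
  - exact: twin_arc.
  - by have [su _] := twin_side _ _ tu; have [_] := twin_side _ _ tv; rewrite -h su.
  - by case: (twin_neq _ _ tu); rewrite h h' ev.
  - by have [_ su] := twin_side _ _ tu; have [] := twin_side _ _ tv; rewrite -h su.
  - by apply/esym/twin_arc.
apply: leq_trans (mixed_chi_le_card cf) _.
have : f @: T \subset ~: [set u in tb].
  apply/subsetP=> _ /imsetP[u _ ->]; rewrite !inE /f; case: ifP => [tu|->//].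
  apply/negP=> /stb; rewrite sta // mem_nth // sa -sb index_mem //.
move/subset_leq_card/leq_trans; apply; rewrite cardsCs setCK cardsE card_sum card_ord.
by rewrite (card_uniqP ub) sb.
Qed.
End PlusCliques.

(** * The 5-cycle, directed 2-paths and 2-colored edges *)

Definition cyc5 (a b : 'I_5) : bool := (b == ordS a) || (a == ordS b).

(** Nonzero differences modulo 5 are 1, 2 or their negatives; so a directed 5-cycle joins any two
    vertices by a directed path of length at most 2. *)
Lemma I5_pairs (a b : 'I_5) : a != b ->
  [|| b == ordS a, a == ordS b, b == ordS (ordS a) | a == ordS (ordS b)].
Proof. by rewrite -!val_eqE /=; have := ltn_ord a; have := ltn_ord b; lia. Qed.

Lemma cyc5_irr a : cyc5 a a = false.
Proof. by rewrite /cyc5 -!val_eqE /=; have := ltn_ord a; lia. Qed.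

Lemma cyc5_dist2 a : cyc5 a (ordS (ordS a)) = false.
Proof. by rewrite /cyc5 -!val_eqE /=; have := ltn_ord a; lia. Qed.

Lemma cyc5_middle a c :
  cyc5 c a -> cyc5 c (ordS (ordS a)) -> c = ordS a.
Proof.
rewrite /cyc5 -!val_eqE /= => h h'; apply: val_inj => /=.
by have := ltn_ord a; have := ltn_ord c; lia.
Qed.

Lemma ordS2_neq (a : 'I_5) : ordS (ordS a) != a.
Proof. by rewrite -val_eqE /=; have := ltn_ord a; lia. Qed.

(** Otherwise the color flips five times around the cycle and returns negated. *)
Lemma cyc5_odd (col : 'I_5 -> bool) : exists p, col p = col (ordS p).
Proof.
case: (pselect (exists p, col p = col (ordS p))) => // no.
have flip p : col (ordS p) = ~~ col p.
  have [e|] := eqVneq (col p) (col (ordS p)); first by case: no; exists p.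
  by case: (col p) (col (ordS p)) => [] [].
have e : iter 5 (@ordS 5) ord0 = ord0 by apply: val_inj.
by have := congr1 col e; rewrite /= !flip !negbK; case: (col ord0).
Qed.

Lemma compat_orient_neq (V W : finType) (r : rel V)
    (r_asym : forall u v, r u v -> ~~ r v u) (f : V -> W) u v :
  compat (orient r_asym) f -> r u v -> f u <> f v.
Proof. by case=> h _ ruv; apply: h; rewrite underlying_orient ruv. Qed.

(** If the ends had the same image, [w] would have an arc both to and from it. *)
Lemma compat_orient_dipath (V W : finType) (r : rel V)
    (r_asym : forall u v, r u v -> ~~ r v u) (f : V -> W) u w v :
  compat (orient r_asym) f -> r u w -> r w v -> f u <> f v.
Proof.
case=> _ h ruw rwv fuv.
have := h u w v w fuv erefl; rewrite !underlying_orient ruw rwv orbT.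
by case=> // /(_ ord0) /= + _; rewrite ruw (negbTE (r_asym _ _ rwv)).
Qed.

(** An adjacent pair has exactly one of the two colors, so one boolean determines its coloring. *)
Lemma bicolored_edge (V : finType) (M : mixed_graph 0 2 V) u v c :
  underlying M u v -> edge M c u v = (edge M ord0 u v == (c == ord0)).
Proof.
move=> /underlyingP[[[]//]|[c0 h0]].
have uniq_c c1 c2 : edge M c1 u v -> edge M c2 u v -> c1 = c2.
  move=> h1 h2; have := mixed_simple M u v.
  move/leq_trans/(_ (leq_b1 _))/(leq_trans (leq_addl _ _)).
  by move/card_le1_eqP; apply; rewrite inE.
case h: (edge M ord0 u v).
  by rewrite eq_sym eqb_id; apply/idP/eqP => [hc|->//]; apply: uniq_c h.
have c0N : c0 != ord0 by apply: contraFneq h => <-.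
rewrite eq_sym eqbF_neg; have [->//|cN] := eqVneq c ord0.
rewrite (_ : c = c0) //.
move: cN c0N; rewrite -!val_eqE => /= cN c0N; apply: val_inj => /=.
by have := ltn_ord c; have := ltn_ord c0; lia.
Qed.

(** * Disjoint 5-cycles connected by directed 2-paths *)

Section Cycles.
Variable k : nat.

Let X : finType := ('I_k * 'I_5)%type.
Let Z : finType := (X * X * bool)%type.
Let V : finType := (X + Z)%type.

(* [k] directed 5-cycles, and a tournament on [Z] in which [(p, q, true)] joins
   [p] to [q], if they lie in distinct cycles, by a directed 2-path, and
   [(p, q, false)] joins [q] to [p].  No vertex of [Z] is adjacent to two
   vertices of the same cycle. *)
Definition cycles_arc : rel V := fun u v =>
  match u, v with
  | inl x, inl y => (x.1 == y.1) && (y.2 == ordS x.2)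
  | inl x, inr (p, q, b) => if b then x == p else (x == q) && (x.1 != p.1)
  | inr (p, q, b), inl x => if b then (x == q) && (x.1 != p.1) else x == p
  | inr z, inr z' =>
    z.2 && ~~ z'.2 || (z.2 == z'.2) && (enum_rank z < enum_rank z')
  end.

Lemma cycles_arc_asym u v : cycles_arc u v -> ~~ cycles_arc v u.
Proof.
case: u v => [[i a]|[[p q] b]] [[j b']|[[p' q'] b']] /=.
- move=> /andP[_ /eqP->]; rewrite negb_and; apply/orP; right.
  by rewrite eq_sym ordS2_neq.
- case: b' => [/eqP<-|/andP[_ ne]]; first by rewrite eqxx andbF.
  by apply: contra ne => /eqP<-.
- case: b => [/andP[_ ne]|/eqP<-]; last by rewrite eqxx andbF.
  by apply: contra ne => /eqP<-.
- by case: b b' => [] [] //= lt; rewrite -leqNgt ltnW.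
Qed.

Definition cycles_rel : rel V := fun u v => cycles_arc u v || cycles_arc v u.

Lemma cycles_sym : symmetric cycles_rel.
Proof. by move=> u v; rewrite /cycles_rel orbC. Qed.

Lemma cycles_irr : irreflexive cycles_rel.
Proof.
move=> u; rewrite /cycles_rel orbb; apply/negP=> h.
by have := cycles_arc_asym h; rewrite h.
Qed.

Definition cycles : simple_graph V := SimpleGraph cycles_sym cycles_irr.

(** By [compat_orient_neq] and [compat_orient_dipath], this forces all images to be distinct. *)
Lemma cycles_oriented_clique u v : u != v ->
  [\/ cycles_arc u v, cycles_arc v u,
      exists w, cycles_arc u w && cycles_arc w v
    | exists w, cycles_arc v w && cycles_arc w u].
Proof.
(* In [Z], arcs go from the [true] vertices to the [false] ones, so [(x, x, true)] leads from [x] to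
   any [false] vertex and [(x, x, false)] leads from any [true] vertex to [x]. *)
have XZ x z : exists w, (cycles_arc (inl x) w && cycles_arc w (inr z)) ||
    (cycles_arc (inr z) w && cycles_arc w (inl x)).
  case: z => [[p q] []].
  - by exists (inr (x, x, false)); rewrite /= !eqxx orbT.
  - by exists (inr (x, x, true)); rewrite /= !eqxx.
case: u v => [x|z] [y|z'] ne.
- have [exy|nxy] := eqVneq x.1 y.1.
    case: x y exy ne => [i a] [j b] /= <- ne.
    have : a != b by apply: contra_neq ne => ->.
    case/I5_pairs/or4P => h.
    + by constructor 1; rewrite /= eqxx.
    + by constructor 2; rewrite /= eqxx.
    + by constructor 3; exists (inl (i, ordS a)); rewrite /= !eqxx.
    + by constructor 4; exists (inl (i, ordS b)); rewrite /= !eqxx.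
  by constructor 3; exists (inr (x, y, true)); rewrite /= !eqxx eq_sym.
- by have [w /orP[]h] := XZ x z'; [constructor 3|constructor 4]; exists w.
- by have [w /orP[]h] := XZ y z; [constructor 4|constructor 3]; exists w.
- have : z != z' by apply: contra_neq ne => ->.
  rewrite -(inj_eq enum_rank_inj) -val_eqE /=.
  case: z z' {ne} => [[p q] b] [[p' q'] b'].
  case: b b' => [] [] //=; rewrite ?neq_ltn; try by [constructor 1|constructor 2].
  all: by case/orP; [constructor 1|constructor 2].
Qed.

Variables (K L : nat).

Lemma chi10_cycles : #|V| <= chi 1 0 (plus_cliques cycles K L 0).
Proof.
pose r : rel (V + 'I_(K + L)) := fun u v =>
  if (u, v) is (inl u, inl v) then cycles_arc u v else false.
have r_asym u v : r u v -> ~~ r v u.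
  by case: u v => [u|x] [v|y] //; apply: cycles_arc_asym.
have rE : underlying (orient r_asym) =2 plus_cliques cycles K L 0.
  by move=> [u|x] [v|y]; rewrite underlying_orient //= andbF.
apply: (leq_chi rE) => W f cf.
suff f_inj : injective (f \o inl) by rewrite -(card_imset _ f_inj) max_card.
move=> u v /= fuv; apply/eqP; apply/negPn/negP => /cycles_oriented_clique[].
- by move=> h; apply: (@compat_orient_neq _ _ _ r_asym _ (inl u) (inl v) cf).
- by move=> h; apply: (@compat_orient_neq _ _ _ r_asym _ (inl v) (inl u) cf).
- case=> w /andP[h h'].
  exact: (@compat_orient_dipath _ _ _ r_asym _ (inl u) (inl w) (inl v) cf).
- case=> w /andP[h h'].
  exact: (@compat_orient_dipath _ _ _ r_asym _ (inl v) (inl w) (inl u) cf).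
Qed.

(** Identifying the ends of a monochromatic 2-path in every cycle saves [k] colors; the [.+1]
    accounts for [None], the common color of the isolated vertices. *)
Lemma chi02_cycles : chi 0 2 (plus_cliques cycles K L 0) <= #|V|.+1 - k.
Proof.
set H := plus_cliques _ _ _ _; apply: chi_leq => M MH.
pose x i a : V + 'I_(K + L) := inl (inl (i, a)).
have /fin_all_exists[p pP] i : exists p,
    edge M ord0 (x i p) (x i (ordS p)) =
    edge M ord0 (x i (ordS p)) (x i (ordS (ordS p))).
  exact: (cyc5_odd (fun p => edge M ord0 (x i p) (x i (ordS p)))).
pose f (u : V + 'I_(K + L)) : option V :=
  match u with
  | inl (inl (i, a)) =>
    Some (inl (i, if a == ordS (ordS (p i)) then p i else a))
  | inl (inr z) => Some (inr z)
  | inr _ => None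
  end.
pose twin u v := exists i, u = x i (p i) /\ v = x i (ordS (ordS (p i))).
have HxE i a j b : H (x i a) (x j b) = (i == j) && cyc5 a b.
  by rewrite /= /cycles_rel /= [j == i]eq_sym -andb_orr.
(* The hypothesis [H u w] sets aside the isolated vertices, which all go to [None]. *)
have fE u v w : H u w -> f u = f v -> [\/ u = v, twin u v | twin v u].
  case: u => [u|y]; last by case: w => [|y'] //=; rewrite andbF.
  case: v => [v|y] _; last by case: u => [[]|].
  case: u v => [[i a]|z] [[j b]|z'] //=; last by case=> ->; constructor 1.
  case=> <-; case: eqP => [->|_]; case: eqP => [->|_].
  - by constructor 1.
  - by move=> <-; constructor 3; exists i.
  - by move=> ->; constructor 2; exists i.
  - by move=> ->; constructor 1.
have HzE z i a : H (inl (inr z)) (x i a) =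
    ((i, a) == z.1.1) || ((i, a) == z.1.2) && (i != z.1.1.1).
  by case: z => [[q q'] []]; rewrite /= /cycles_rel /= // orbC.
(* The only common neighbor of two twins is the middle of their 2-path, whose two edges have the
   same color by the choice of [p]. *)
have nbr w u v : twin u v -> H w u -> H w v ->
    forall c, edge M c w u = edge M c w v.
  case=> i [-> ->] h h' c.
  rewrite (@bicolored_edge _ M w) ?MH // [RHS]bicolored_edge ?MH //.
  suff -> : w = x i (ordS (p i)) by rewrite -pP edge_sym.
  case: w h h' => [[[j a]|z]|//].
    rewrite -/(x j a) !HxE => /andP[/eqP-> h] /andP[_ h'].
    by rewrite (cyc5_middle h h').
  have ne := ordS2_neq (p i); rewrite !HzE.
  move=> /orP[/eqP e|/andP[/eqP e n]] /orP[/eqP e'|/andP[/eqP e' n']].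
  - by move: e'; rewrite -e => -[/eqP]; rewrite (negbTE ne).
  - by rewrite -e eqxx in n'.
  - by rewrite -e' eqxx in n.
  - by move: e'; rewrite -e => -[/eqP]; rewrite (negbTE ne).
pose endp u := exists i, u = x i (p i) \/ u = x i (ordS (ordS (p i))).
have twin_endp u v : twin u v -> endp u /\ endp v.
  by case=> i [-> ->]; split; exists i; [left|right].
(* Ends in the same cycle are equal or at distance 2, and distinct cycles are not adjacent. So no
   edge has both ends in twin pairs. *)
have endpN u v : endp u -> endp v -> ~~ H u v.
  case=> i [] -> [j [] ->]; rewrite HxE; apply/negP=> /andP[/eqP<-].
  - by rewrite cyc5_irr.
  - by rewrite cyc5_dist2.
  - by rewrite /cyc5 orbC -/(cyc5 _ _) cyc5_dist2.
  - by rewrite cyc5_irr.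
have cf : compat M f.
  split=> [u v|u v u' v' fu fv]; rewrite !MH => h.
    case/(fE _ _ _ h) => [e|/twin_endp[eu ev]|/twin_endp[ev eu]].
    - by move: h; rewrite e adj_irr.
    - by have := endpN _ _ eu ev; rewrite h.
    - by have := endpN _ _ eu ev; rewrite h.
  move=> h'; split=> [[]//|c].
  have hs : H v u by rewrite adj_sym.
  have hs' : H v' u' by rewrite adj_sym.
  case: (fE _ _ _ h fu) (fE _ _ _ hs fv) => [eu|tu|tu] [ev|tv|tv].
  - by rewrite eu ev.
  - by move: h h'; rewrite -eu => h h'; apply: nbr.
  - by move: h h'; rewrite -eu => h h'; apply/esym/nbr.
  - by move: hs hs'; rewrite -ev !(edge_sym M c _ v) => h1 h2; apply: nbr.
  - have [eu _] := twin_endp _ _ tu; have [ev _] := twin_endp _ _ tv.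
    by have := endpN _ _ eu ev; rewrite h.
  - have [eu _] := twin_endp _ _ tu; have [_ ev] := twin_endp _ _ tv.
    by have := endpN _ _ eu ev; rewrite h.
  - by move: hs hs'; rewrite -ev !(edge_sym M c _ v) => h1 h2; apply/esym/nbr.
  - have [_ eu] := twin_endp _ _ tu; have [ev _] := twin_endp _ _ tv.
    by have := endpN _ _ eu ev; rewrite h.
  - have [_ eu] := twin_endp _ _ tu; have [_ ev] := twin_endp _ _ tv.
    by have := endpN _ _ eu ev; rewrite h.
apply: leq_trans (mixed_chi_le_card cf) _.
pose missed i : option V := Some (inl (i, ordS (ordS (p i)))).
have missed_inj : injective missed by move=> i j [].
pose T : finType := (V + 'I_(K + L))%type.
have : f @: T \subset ~: (missed @: 'I_k).
  apply/subsetP=> _ /imsetP[u _ ->]; rewrite inE; apply/negP=> /imsetP[j _].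
  case: u => [[[i a]|z]|//] //= [<-]; case: eqP => // _ /eqP.
  by rewrite eq_sym (negbTE (ordS2_neq _)).
move/subset_leq_card/leq_trans; apply.
by rewrite cardsCs setCK card_imset // card_option card_ord.
Qed.
End Cycles.

(** * Intermediate values of the difference *)

(** [K] and [L] come after [G] because the clique sizes will be chosen depending on [#|V|]. *)
Lemma chi02_lt_chi10 (m : nat) : exists (V : finType) (G : simple_graph V),
  forall K L, chi 0 2 (plus_cliques G K L 0) + m <= #|V| /\
              #|V| <= chi 1 0 (plus_cliques G K L 0).
Proof.
(* One cycle more than [m] offsets the color of the isolated vertices. *)
exists _, (cycles m.+1) => K L; split; last exact: chi10_cycles.
have := chi02_cycles m.+1 K L; set v := #|_|; suff: m <= v by lia.
rewrite /v card_sum card_prod !card_ord; lia.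
Qed.

(** Only upward steps need a bound: if [d N < n <= d N.+1], then [d N.+1 = n]. *)
Lemma int_ivt (d : nat -> int) (n : int) (N : nat) :
  (d 0 <= n)%R -> (n <= d N)%R ->
  (forall j, j < N -> (d j.+1 <= d j + 1)%R) -> exists j, d j = n.
Proof.
move=> d0; elim: N => [|N IHN] dN step; first by exists 0; move: (d 0) d0 dN; lia.
have [le|lt] := boolP (n <= d N)%R; first by apply: IHN => // j ?; apply: step; lia.
by exists N.+1; move: (step N (leqnn _)) lt dN; move: (d N) (d N.+1); lia.
Qed.

Local Open Scope ring_scope.

Theorem theorem5 (n : int) :
  exists (V : finType) (G : simple_graph V),
    (chi 0 2 G)%:Z - (chi 1 0 G)%:Z = n.
Proof.
have [V [G gap]] := chi02_lt_chi10 `|n|%N.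
(* With [E = 2 ^ s], the final difference is at least [(2 * E - 1) - (#|V| + 2 * E - s)], which is
   the absolute value of [n]. *)
pose s := (#|V| + `|n|.+1)%N; pose H := plus_cliques G (2 ^ s) (2 ^ s).
suff [j] : exists j, (chi 0 2 (H j))%:Z - (chi 1 0 (H j))%:Z = n.
  by exists _, (H j).
apply: (int_ivt (d := fun j => (chi 0 2 (H j))%:Z - (chi 1 0 (H j))%:Z)
                (N := 2 ^ s + 2 ^ s)).
- have [] := gap (2 ^ s)%N (2 ^ s)%N; rewrite -/(H 0%N).
  by move: (chi 0 2 _) (chi 1 0 _) => a b; lia.
(* This keeps the truncated subtraction of [s] exact. *)
- have lt_s : (s < 2 ^ s)%N by apply: ltn_expl.
  have := chi02_two_cliques G (2 ^ s) (2 ^ s).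
  have := chi10_two_cliques G (leqnn (2 ^ s)) (leqnn (2 ^ s)).
  rewrite -/(H _); move: lt_s (chi 0 2 _) (chi 1 0 _).
  by move: (2 ^ s)%N => E lt_s a b; lia.
- move=> j ltj; have := chi_plus_cliques_step G 0 2 ltj.
  have := leq_chi_oriented (@plus_cliques_sub _ G (2 ^ s) (2 ^ s) j).
  rewrite -!/(H _); move: (chi 0 2 _) (chi 1 0 _) (chi 0 2 _) (chi 1 0 _).
  by move=> a b c d; lia.
Qed.
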